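(* Let $(H,\cdot,\circ,\sigma)$ be a Hopf truss, let $S$ be the antipode of the Hopf algebra $(H,\cdot,\Delta,\varepsilon)$, and let $x\in G(H)$. Define $$a\cdot_x b=aS(x)b,\qquad \sigma_x(a)=a\circ x\qquad(a,b\in H).$$ Then $(H,\cdot_x,\circ,\sigma_x)$ is a Hopf truss.
   Context: Everything is over a fixed field $\mathbf{k}$. Sweedler notation $\Delta(c)=c_1\otimes c_2$ is used; $G(H)$ is the set of group-like elements. A nonunital bialgebra $(H,\circ,\Delta,\varepsilon)$ is a coalgebra with an associative (not necessarily unital) multiplication $\circ$ that is a coalgebra map $H\otimes H\to H$. A (left) Hopf truss $(H,\cdot,\circ,\sigma)$ is a coalgebra $(H,\Delta,\varepsilon)$ with a Hopf algebra structure $(H,\cdot,\Delta,\varepsilon)$ (with a unit and antipode $S$), a nonunital bialgebra structure $(H,\circ,\Delta,\varepsilon)$, and a coalgebra endomorphism $\sigma$ of $H$ such that $a\circ(b\cdot c)=(a_1\circ b)\cdot S(\sigma(a_2))\cdot(a_3\circ c)$ for all $a,b,c\in H$. (For $(H,\cdot_x,\circ,\sigma_x)$ the antipode in this axiom is that of $(H,\cdot_x)$, and the unit of $(H,\cdot_x)$ is $x$.) *)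

(* Defs.v *)
From HB Require Import structures.
From mathcomp Require Import all_boot all_order all_algebra.
From mathcomp Require Import generic_quotient boolp.

Set Implicit Arguments.
Unset Strict Implicit.
Unset Printing Implicit Defensive.

Import GRing.Theory.
Local Open Scope ring_scope.
Local Open Scope quotient_scope.

Reserved Notation "V ⊗ W" (at level 40, left associativity).

Definition bilinear_map (k : fieldType) (V W U : lmodType k)
    (f : V -> W -> U) : Prop :=
  (forall w, linear (f^~ w)) /\ (forall v, linear (f v)).

(* The tensor product is built as formal sums of pairs (v, w), two sums being
   identified when no bilinear map distinguishes them.  Its universal property
   is given by tens_bilinear, tlift_linear, tliftE and tens_ext below. *)
Section TensorProduct.
Variables (k : fieldType) (V W : lmodType k).

Definition eval_sum (U : lmodType k) (f : V -> W -> U) (s : seq (V * W)) : U :=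
  \sum_(p <- s) f p.1 p.2.

Definition tensor_rel (s t : seq (V * W)) : bool :=
  `[< forall (U : lmodType k) (f : V -> W -> U),
        bilinear_map f -> eval_sum f s = eval_sum f t >].

Lemma tensor_rel_refl : reflexive tensor_rel.
Proof. by move=> s; apply/asboolP. Qed.

Lemma tensor_rel_sym : symmetric tensor_rel.
Proof.
by move=> s t; apply/asboolP/asboolP => h U f bf; rewrite (h U f bf).
Qed.

Lemma tensor_rel_trans : transitive tensor_rel.
Proof.
move=> t s u /asboolP st /asboolP tu; apply/asboolP => U f bf.
by rewrite (st U f bf) (tu U f bf).
Qed.

Canonical tensor_equiv :=
  EquivRel tensor_rel tensor_rel_refl tensor_rel_sym tensor_rel_trans.

Definition tensor := {eq_quot tensor_equiv}.

HB.instance Definition _ := Choice.on tensor.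

Definition tclass (s : seq (V * W)) : tensor := \pi_{eq_quot tensor_equiv} s.
Definition trepr (t : tensor) : seq (V * W) := repr (t : {eq_quot tensor_equiv}).

Definition tens (v : V) (w : W) : tensor := tclass [:: (v, w)].

(* Meaningful for bilinear f only, where the value does not depend on the
   chosen representative and tlift f is the linear map induced by f. *)
Definition tlift (U : lmodType k) (f : V -> W -> U) (t : tensor) : U :=
  eval_sum f (trepr t).

Lemma tclassP s t :
  (forall (U : lmodType k) (f : V -> W -> U),
     bilinear_map f -> eval_sum f s = eval_sum f t) ->
  tclass s = tclass t.
Proof. by move=> h; apply/eqmodP/asboolP. Qed.

Lemma tlift_class (U : lmodType k) (f : V -> W -> U) s :
  bilinear_map f -> tlift f (tclass s) = eval_sum f s.
Proof.
move=> bf; have /eqmodP/asboolP : tclass (trepr (tclass s)) = tclass s.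
  exact: reprK.
exact.
Qed.

Lemma treprK t : tclass (trepr t) = t.
Proof. exact: reprK. Qed.

Lemma tensor_eqP (s t : tensor) :
  (forall (U : lmodType k) (f : V -> W -> U),
     bilinear_map f -> tlift f s = tlift f t) -> s = t.
Proof. by move=> h; rewrite -[s]treprK -[t]treprK; apply: tclassP. Qed.

Definition tzero : tensor := tclass [::].
Definition tadd (s t : tensor) : tensor := tclass (trepr s ++ trepr t).
Definition tscale (a : k) (t : tensor) : tensor :=
  tclass [seq (a *: p.1, p.2) | p <- trepr t].
Definition topp : tensor -> tensor := tscale (-1).

Section Lift.
Variables (U : lmodType k) (f : V -> W -> U).
Hypothesis bf : bilinear_map f.

Lemma tlift0_subproof : tlift f tzero = 0.
Proof. by rewrite tlift_class // /eval_sum big_nil. Qed.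

Lemma tliftD_subproof s t : tlift f (tadd s t) = tlift f s + tlift f t.
Proof. by rewrite tlift_class // /eval_sum big_cat. Qed.

Lemma tliftZ_subproof a t : tlift f (tscale a t) = a *: tlift f t.
Proof.
rewrite tlift_class // /tlift /eval_sum big_map scaler_sumr.
apply: eq_bigr => p _ /=.
have f0 : f 0 p.2 = 0.
  by have := bf.1 p.2 (-1) 0 0; rewrite scaler0 addr0 scaleN1r addNr.
by have := bf.1 p.2 a p.1 0; rewrite addr0 f0 addr0.
Qed.

End Lift.

Let tliftS := (tlift0_subproof, tliftD_subproof, tliftZ_subproof).

Lemma taddA : associative tadd.
Proof. by move=> s t u; apply: tensor_eqP => U f bf; rewrite !tliftS // addrA. Qed.

Lemma taddC : commutative tadd.
Proof. by move=> s t; apply: tensor_eqP => U f bf; rewrite !tliftS // addrC. Qed.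

Lemma tadd0 : left_id tzero tadd.
Proof. by move=> s; apply: tensor_eqP => U f bf; rewrite !tliftS // add0r. Qed.

Lemma taddN : left_inverse tzero topp tadd.
Proof.
by move=> s; apply: tensor_eqP => U f bf; rewrite !tliftS // scaleN1r addNr.
Qed.

HB.instance Definition _ :=
  GRing.isZmodule.Build tensor taddA taddC tadd0 taddN.

Lemma tscaleA a b t : tscale a (tscale b t) = tscale (a * b) t.
Proof. by apply: tensor_eqP => U f bf; rewrite !tliftS // scalerA. Qed.

Lemma tscale1 : left_id 1 tscale.
Proof. by move=> t; apply: tensor_eqP => U f bf; rewrite !tliftS // scale1r. Qed.

Lemma tscaleDr : right_distributive tscale +%R.
Proof.
by move=> a s t; apply: tensor_eqP => U f bf; rewrite !tliftS // scalerDr.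
Qed.

Lemma tscaleDl t : {morph tscale^~ t : a b / a + b}.
Proof.
by move=> a b; apply: tensor_eqP => U f bf; rewrite !tliftS // scalerDl.
Qed.

HB.instance Definition _ :=
  GRing.Zmodule_isLmodule.Build k tensor tscaleA tscale1 tscaleDr tscaleDl.

Lemma tlift_linear (U : lmodType k) (f : V -> W -> U) :
  bilinear_map f -> linear (tlift f).
Proof. by move=> bf a s t; rewrite tliftD_subproof // tliftZ_subproof. Qed.

Lemma tliftE (U : lmodType k) (f : V -> W -> U) v w :
  bilinear_map f -> tlift f (tens v w) = f v w.
Proof. by move=> bf; rewrite tlift_class // /eval_sum big_seq1. Qed.

Lemma tens_bilinear : bilinear_map tens.
Proof.
split=> [w a v v' | v a w w'] /=; apply: tensor_eqP => U f bf;
  rewrite (tlift_linear bf) !tliftE //; [exact: bf.1 | exact: bf.2].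
Qed.

Lemma tens_span (t : tensor) : t = \sum_(p <- trepr t) tens p.1 p.2.
Proof.
rewrite -[LHS]treprK; elim: (trepr t) => [|[v w] s ih]; first by rewrite big_nil.
rewrite big_cons -ih /=; apply: tensor_eqP => U f bf.
rewrite tliftD_subproof // tliftE // !tlift_class // /eval_sum.
by rewrite big_cons.
Qed.

End TensorProduct.

Notation "V ⊗ W" := (tensor V%type W%type) : type_scope.
Notation "v ⊗ w" := (tens v w) : ring_scope.

Lemma linear0_sum (k : fieldType) (V U : lmodType k) (f : V -> U)
    (I : Type) (s : seq I) (F : I -> V) :
  linear f -> f (\sum_(i <- s) F i) = \sum_(i <- s) f (F i).
Proof.
move=> lf.
have f0 : f 0 = 0 by have := lf (-1) 0 0; rewrite scaler0 addr0 scaleN1r addNr.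
elim: s => [|i s ih]; first by rewrite !big_nil.
by rewrite !big_cons -ih; have := lf 1 (F i) (\sum_(j <- s) F j); rewrite !scale1r.
Qed.

Lemma tens_ext (k : fieldType) (V W U : lmodType k) (f g : V ⊗ W -> U) :
  linear f -> linear g -> (forall v w, f (v ⊗ w) = g (v ⊗ w)) -> f =1 g.
Proof.
move=> lf lg fg t; rewrite (tens_span t) !linear0_sum //.
by apply: eq_bigr => p _.
Qed.

Lemma tens_ext2 (k : fieldType) (V W V' W' U : lmodType k)
    (f g : V ⊗ W -> V' ⊗ W' -> U) :
  bilinear_map f -> bilinear_map g ->
  (forall v w v' w', f (v ⊗ w) (v' ⊗ w') = g (v ⊗ w) (v' ⊗ w')) -> f =2 g.
Proof.
move=> [fl fr] [gl gr] fg s t.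
apply: (@tens_ext _ _ _ _ (f^~ t) (g^~ t)) => //= v w.
by apply: tens_ext => // v' w'.
Qed.

Section TensorMaps.
Variable k : fieldType.

Lemma tensPl (V W : lmodType k) a (v v' : V) (w : W) :
  (a *: v + v') ⊗ w = a *: (v ⊗ w) + v' ⊗ w.
Proof. exact: (tens_bilinear V W).1. Qed.

Lemma tensPr (V W : lmodType k) a (v : V) (w w' : W) :
  v ⊗ (a *: w + w') = a *: (v ⊗ w) + v ⊗ w'.
Proof. exact: (tens_bilinear V W).2. Qed.

Lemma tensZl (V W : lmodType k) a (v : V) (w : W) : (a *: v) ⊗ w = a *: (v ⊗ w).
Proof.
have t0 : (0 : V) ⊗ w = 0.
  by have := tensPl (-1) (0 : V) 0 w; rewrite scaler0 addr0 scaleN1r addNr.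
by have := tensPl a v 0 w; rewrite t0 !addr0.
Qed.

Lemma tensZr (V W : lmodType k) a (v : V) (w : W) : v ⊗ (a *: w) = a *: (v ⊗ w).
Proof.
have t0 : v ⊗ (0 : W) = 0.
  by have := tensPr (-1) v (0 : W) 0; rewrite scaler0 addr0 scaleN1r addNr.
by have := tensPr a v w 0; rewrite t0 !addr0.
Qed.

Definition tmap (V W V' W' : lmodType k) (f : V -> V') (g : W -> W') :
    V ⊗ W -> V' ⊗ W' :=
  tlift (fun v w => f v ⊗ g w).

Definition tassoc (V W Z : lmodType k) : (V ⊗ W) ⊗ Z -> V ⊗ (W ⊗ Z) :=
  tlift (fun t z => tlift (fun v w => v ⊗ (w ⊗ z)) t).

Definition tswap_mid (V W V' W' : lmodType k) :
    (V ⊗ W) ⊗ (V' ⊗ W') -> (V ⊗ V') ⊗ (W ⊗ W') :=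
  tlift (fun s t =>
    tlift (fun v w => tlift (fun v' w' => (v ⊗ v') ⊗ (w ⊗ w')) t) s).

Section Tmap.
Variables (V W V' W' : lmodType k).
Variables (f : {linear V -> V'}) (g : {linear W -> W'}).

Lemma tmap_bilinear : bilinear_map (fun v w => f v ⊗ g w).
Proof. by split=> [w|v] a x y /=; rewrite linearP ?tensPl ?tensPr. Qed.

HB.instance Definition _ := GRing.isLinear.Build k (V ⊗ W)%type (V' ⊗ W')%type _
  (tmap f g) (tlift_linear tmap_bilinear).

Lemma tmapE v w : tmap f g (v ⊗ w) = f v ⊗ g w.
Proof. exact: tliftE tmap_bilinear. Qed.

End Tmap.

Section TliftTwice.
Variables (V W Z U : lmodType k) (f : V -> W -> Z -> U).
Hypothesis f1 : forall w z, linear (fun v => f v w z).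
Hypothesis f2 : forall v z, linear (fun w => f v w z).
Hypothesis f3 : forall v w, linear (f v w).

Lemma tlift_param_bilinear :
  bilinear_map (fun t z => tlift (fun v w => f v w z) t).
Proof.
split=> [z|t] a; first by apply: tlift_linear; split=> [w|v].
move=> z z'; rewrite /tlift /eval_sum scaler_sumr -big_split.
by apply: eq_bigr => p _; rewrite f3.
Qed.

End TliftTwice.

Section Tassoc.
Variables V W Z : lmodType k.

Lemma tassoc_bilinear :
  bilinear_map (fun (t : V ⊗ W) (z : Z) => tlift (fun v w => v ⊗ (w ⊗ z)) t).
Proof.
by apply: tlift_param_bilinear => [w z|v z|v w] a x y;
  rewrite ?tensPr ?tensPl ?tensPr.
Qed.

HB.instance Definition _ := GRing.isLinear.Build k ((V ⊗ W) ⊗ Z)%type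
  (V ⊗ (W ⊗ Z))%type _
  (@tassoc V W Z) (tlift_linear tassoc_bilinear).

Lemma tassocE (v : V) (w : W) (z : Z) : tassoc ((v ⊗ w) ⊗ z) = v ⊗ (w ⊗ z).
Proof.
rewrite /tassoc tliftE; last exact: tassoc_bilinear.
by rewrite tliftE //; split=> [w'|v'] a x y; rewrite ?tensPl ?tensPr ?tensPl ?tensPr.
Qed.

End Tassoc.

Section TswapMid.
Variables V W V' W' : lmodType k.

Let bil4 (v : V) (w : W) :
  bilinear_map (fun (v' : V') (w' : W') => (v ⊗ v') ⊗ (w ⊗ w')).
Proof. by split=> [w'|v'] a x y; rewrite !tensPr ?tensPl. Qed.

Let bil2 (t : V' ⊗ W') : bilinear_map (fun (v : V) (w : W) =>
  tlift (fun v' w' => (v ⊗ v') ⊗ (w ⊗ w')) t).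
Proof.
split=> [w|v] a x y; rewrite /tlift /eval_sum scaler_sumr -big_split;
  by apply: eq_bigr => p _; rewrite ?tensPl ?tensPr.
Qed.

Lemma tswap_mid_bilinear :
  bilinear_map (fun (s : V ⊗ W) (t : V' ⊗ W') =>
    tlift (fun v w => tlift (fun v' w' => (v ⊗ v') ⊗ (w ⊗ w')) t) s).
Proof.
apply: (tlift_param_bilinear
  (f := fun v w t => tlift (fun v' w' => (v ⊗ v') ⊗ (w ⊗ w')) t))
  => [w t|v t|v w]; last exact: tlift_linear.
- exact: (bil2 t).1.
- exact: (bil2 t).2.
Qed.

HB.instance Definition _ := GRing.isLinear.Build k
  ((V ⊗ W) ⊗ (V' ⊗ W'))%type ((V ⊗ V') ⊗ (W ⊗ W'))%type _
  (@tswap_mid V W V' W') (tlift_linear tswap_mid_bilinear).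

Lemma tswap_midE (v : V) (w : W) (v' : V') (w' : W') :
  tswap_mid ((v ⊗ w) ⊗ (v' ⊗ w')) = (v ⊗ v') ⊗ (w ⊗ w').
Proof.
by rewrite /tswap_mid tliftE ?tliftE //; exact: tswap_mid_bilinear.
Qed.

End TswapMid.

End TensorMaps.

(* comulA, counitl and counitr read (Δ ⊗ id)Δ = (id ⊗ Δ)Δ (up to the associator),
   ε(c_1) c_2 = c and c_1 ε(c_2) = c. *)
HB.mixin Record Lmodule_isCoalgebra (k : fieldType) H of GRing.Lmodule k H := {
  comul : {linear H -> (H ⊗ H)%type};
  counit : {scalar H};
  comulA : forall c,
    tassoc (tmap comul idfun (comul c)) = tmap idfun comul (comul c);
  counitl : forall c, tlift (fun c1 c2 => counit c1 *: c2) (comul c) = c;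
  counitr : forall c, tlift (fun c1 c2 => counit c2 *: c1) (comul c) = c
}.

#[short(type="coalgType")]
HB.structure Definition Coalgebra (k : fieldType) :=
  { H of Lmodule_isCoalgebra k H & GRing.Lmodule k H }.

Lemma scalel_bilinear (k : fieldType) (V W : lmodType k) (f : {scalar V}) :
  bilinear_map (fun (v : V) (w : W) => f v *: w).
Proof.
split=> [w|v] a x y /=; first by rewrite linearP scalerDl scalerA.
by rewrite scalerDr !scalerA mulrC.
Qed.

Lemma scaler_bilinear (k : fieldType) (V W : lmodType k) (f : {scalar W}) :
  bilinear_map (fun (v : V) (w : W) => f w *: v).
Proof. by have [h1 h2] := scalel_bilinear V f; split. Qed.

Section TensorCoalgebra.
Variables (k : fieldType) (C D : coalgType k).

Definition tcomul : C ⊗ D -> (C ⊗ D) ⊗ (C ⊗ D) :=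
  @tswap_mid k C C D D \o tmap comul comul.

Definition tcounit : C ⊗ D -> k :=
  tlift (U := k^o) (fun c d => counit c * counit d).

HB.instance Definition _ := GRing.Linear.copy tcomul
  (@tswap_mid k C C D D \o tmap comul comul).

Lemma tcounit_bilinear :
  bilinear_map (fun (c : C) (d : D) => (counit c * counit d : k^o)).
Proof.
split=> [d|c] a x y; rewrite linearP.
  by rewrite mulrDl -mulrA.
by rewrite mulrDr mulrCA.
Qed.

HB.instance Definition _ := GRing.isLinear.Build k (C ⊗ D)%type k *%R tcounit
  (tlift_linear tcounit_bilinear).

Lemma tcomulE (c : C) (d : D) :
  tcomul (c ⊗ d) = tswap_mid (comul c ⊗ comul d).
Proof. by rewrite /tcomul /= tmapE. Qed.

Lemma tcounitE (c : C) (d : D) : tcounit (c ⊗ d) = counit c * counit d.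
Proof. exact: tliftE tcounit_bilinear. Qed.

Local Ltac bilin :=
  split=> [?|?] ? ? ? /=; do ?rewrite ?tensPl ?tensPr linearP.

Lemma tcomulA (t : C ⊗ D) :
  tassoc (tmap tcomul idfun (tcomul t)) = tmap idfun tcomul (tcomul t).
Proof.
move: t; apply: tens_ext; [by move=> a x y; rewrite !linearP..|].
move=> c d.
pose N (u : C ⊗ (C ⊗ C)) (v : D ⊗ (D ⊗ D)) :=
  tmap idfun (@tswap_mid k C C D D) (tswap_mid (u ⊗ v)).
have L : forall u v, tassoc (tmap tcomul idfun (tswap_mid (u ⊗ v)))
    = N (tassoc (tmap comul idfun u)) (tassoc (tmap comul idfun v)).
  apply: tens_ext2; rewrite /N; [by bilin|by bilin|] => x y x' y'.
  rewrite tswap_midE !tmapE /= tcomulE.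
  move: (comul x) (comul x'); apply: tens_ext2; [by bilin|by bilin|].
  by move=> z w z' w'; rewrite !tassocE !tswap_midE tassocE tmapE /= tswap_midE.
have R : forall u v, tmap idfun tcomul (tswap_mid (u ⊗ v))
    = N (tmap idfun comul u) (tmap idfun comul v).
  apply: tens_ext2; rewrite /N; [by bilin|by bilin|] => x y x' y'.
  by rewrite tswap_midE !tmapE /= tcomulE tswap_midE tmapE.
by rewrite tcomulE L R !comulA.
Qed.

Lemma tcounitl (t : C ⊗ D) : tlift (fun s t => tcounit s *: t) (tcomul t) = t.
Proof.
have bt := scalel_bilinear (C ⊗ D)%type tcounit.
have bc := scalel_bilinear C (@counit k C).
have bd := scalel_bilinear D (@counit k D).
move: t; apply: tens_ext => // [a x y|c d]; first by rewrite linearP (tlift_linear bt).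
rewrite tcomulE -[c in RHS]counitl -[d in RHS]counitl.
move: (comul c) (comul d); apply: tens_ext2.
- by bilin; rewrite (tlift_linear bt).
- by split=> [?|?] ? ? ? /=; rewrite ?(tlift_linear bc) ?(tlift_linear bd)
    ?tensPl ?tensPr.
move=> x y x' y'; rewrite tswap_midE !tliftE // tcounitE.
by rewrite tensZl tensZr scalerA.
Qed.

Lemma tcounitr (t : C ⊗ D) : tlift (fun s t => tcounit t *: s) (tcomul t) = t.
Proof.
have bt := scaler_bilinear (C ⊗ D)%type tcounit.
have bc := scaler_bilinear C (@counit k C).
have bd := scaler_bilinear D (@counit k D).
move: t; apply: tens_ext => // [a x y|c d]; first by rewrite linearP (tlift_linear bt).
rewrite tcomulE -[c in RHS]counitr -[d in RHS]counitr.
move: (comul c) (comul d); apply: tens_ext2.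
- by bilin; rewrite (tlift_linear bt).
- by split=> [?|?] ? ? ? /=; rewrite ?(tlift_linear bc) ?(tlift_linear bd)
    ?tensPl ?tensPr.
move=> x y x' y'; rewrite tswap_midE !tliftE // tcounitE.
by rewrite tensZl tensZr scalerA.
Qed.

HB.instance Definition _ :=
  Lmodule_isCoalgebra.Build k (C ⊗ D)%type tcomulA tcounitl tcounitr.

End TensorCoalgebra.

Section HopfTruss.
Variable k : fieldType.

Definition coalgebra_map (C D : coalgType k) (f : C -> D) : Prop :=
  [/\ linear f,
      forall c, comul (f c) = tmap f f (comul c)
    & forall c, counit (f c) = counit c].

Variable H : coalgType k.
Implicit Types (dot circ : H -> H -> H) (one x : H) (S sigma : H -> H).

Definition grouplike x : Prop := comul x = x ⊗ x /\ counit x = 1.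

(* sweedler f a and sweedler3 f a stand for f(a_1, a_2) and f(a_1, a_2, a_3);
   f is meant to be multilinear. *)
Definition sweedler (U : lmodType k) (f : H -> H -> U) (a : H) : U :=
  tlift f (comul a).

Definition sweedler3 (U : lmodType k) (f : H -> H -> H -> U) (a : H) : U :=
  sweedler (fun a1 a' => sweedler (fun a2 a3 => f a1 a2 a3) a') a.

Record nonunital_bialgebra circ : Prop := NonunitalBialgebra {
  nb_bilinear : bilinear_map circ;
  nb_assoc : associative circ;
  nb_coalgebra_map : coalgebra_map (tlift circ : H ⊗ H -> H)
}.

(* The field ha_one says that the unit k -> H is a coalgebra map. *)
Record hopf_algebra dot one S : Prop := HopfAlgebra {
  ha_nonunital : nonunital_bialgebra dot;
  ha_left_id : left_id one dot;
  ha_right_id : right_id one dot;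
  ha_one : grouplike one;
  ha_antipode_linear : linear S;
  ha_antipode_left :
    forall a, sweedler (fun a1 a2 => dot (S a1) a2) a = counit a *: one;
  ha_antipode_right :
    forall a, sweedler (fun a1 a2 => dot a1 (S a2)) a = counit a *: one
}.

(* The unit and the antipode of (H, dot), which are determined by dot, are
   parameters. *)
Record hopf_truss dot one S circ sigma : Prop := HopfTruss {
  ht_hopf : hopf_algebra dot one S;
  ht_nonunital : nonunital_bialgebra circ;
  ht_sigma : coalgebra_map sigma;
  ht_distr : forall a b c,
    circ a (dot b c) =
      sweedler3 (fun a1 a2 a3 =>
        dot (dot (circ a1 b) (S (sigma a2))) (circ a3 c)) a
}.

End HopfTruss.

(* Main.v *)
(** Maps from a coalgebra to an algebra form a monoid under convolution [*],
with unit 1ε, and the antipode law says that [S ∘ f] inverts a coalgebra map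
[f].  Write [T = S ∘ σ] and [R_b a = a ∘ b].  The truss axiom reads
[R_(b·c) = R_b * T * R_c].  For [b = c = 1] it gives [R_1 = σ], so for
[b = x], [c = S x] it gives [R_x * T * R_(S x) = σ]; hence
[T * R_(S x) * T] inverts [R_x = σ_x], i.e. it equals [S ∘ σ_x].  Applying the
truss axiom twice to [b · S x · c] now yields
[R_(b S(x) c) = R_b * (S ∘ σ_x) * R_c], which is the axiom for [(·_x, σ_x)]
because the antipode of [·_x] is [a ↦ x · S a · x]. *)
Require Import Defs.
From mathcomp Require Import all_boot all_order all_algebra.
From mathcomp Require Import boolp.

Set Implicit Arguments.
Unset Strict Implicit.
Unset Printing Implicit Defensive.

Import GRing.Theory.
Local Open Scope ring_scope.

(** * Linear and bilinear maps out of tensor products *)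

Section LinearMaps.
Variable k : fieldType.

Lemma linear_mapZ (V W : lmodType k) (f : V -> W) a v :
  linear f -> f (a *: v) = a *: f v.
Proof.
move=> lf; have f0 : f 0 = 0.
  by have := lf (-1) 0 0; rewrite scaler0 addr0 scaleN1r addNr.
by have := lf a v 0; rewrite f0 !addr0.
Qed.

Lemma linear_comp (V W Z : lmodType k) (f : V -> W) (g : W -> Z) :
  linear f -> linear g -> linear (fun v => g (f v)).
Proof. by move=> lf lg a u v; rewrite lf lg. Qed.

Lemma bilinear_comp (V V' W W' U : lmodType k) (m : V' -> W' -> U)
    (f : V -> V') (g : W -> W') :
  bilinear_map m -> linear f -> linear g ->
  bilinear_map (fun v w => m (f v) (g w)).
Proof.
move=> [ml mr] lf lg; split=> [w|v] a y z /=; first by rewrite lf; exact: ml.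
by rewrite lg; exact: mr.
Qed.

(** By construction [tlift f t] is a finite sum over the chosen representative of [t], and [L]
    passes through finite sums. *)
Lemma linear_tlift (V W U U' : lmodType k) (L : U -> U') (f : V -> W -> U) t :
  linear L -> L (tlift f t) = tlift (fun v w => L (f v w)) t.
Proof. by move=> lL; rewrite /tlift /eval_sum linear0_sum. Qed.

Lemma eq_tlift (V W U : lmodType k) (f g : V -> W -> U) t :
  f =2 g -> tlift f t = tlift g t.
Proof. by move=> fg; apply: eq_bigr => p _; apply: fg. Qed.

Lemma tmap_linear (V W V' W' : lmodType k) (f : V -> V') (g : W -> W') :
  linear f -> linear g -> linear (tmap f g).
Proof.
by move=> lf lg; apply: tlift_linear; apply: bilinear_comp lf lg;
  exact: tens_bilinear.
Qed.

Lemma tmap_tens (V W V' W' : lmodType k) (f : V -> V') (g : W -> W') v w :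
  linear f -> linear g -> tmap f g (v ⊗ w) = f v ⊗ g w.
Proof.
move=> lf lg; rewrite /tmap tliftE //.
by apply: bilinear_comp lf lg; exact: tens_bilinear.
Qed.

Lemma tlift_tmap (V W V' W' U : lmodType k) (m : V' -> W' -> U)
    (f : V -> V') (g : W -> W') t :
  bilinear_map m -> linear f -> linear g ->
  tlift m (tmap f g t) = tlift (fun v w => m (f v) (g w)) t.
Proof.
move=> bm lf lg; rewrite {1}/tmap linear_tlift; last exact: tlift_linear.
by apply: eq_tlift => v w; rewrite tliftE.
Qed.

Lemma tmap_comp (V W V' W' V'' W'' : lmodType k) (f' : V' -> V'')
    (g' : W' -> W'') (f : V -> V') (g : W -> W') t :
  linear f' -> linear g' -> linear f -> linear g ->
  tmap f' g' (tmap f g t) = tmap (fun v => f' (f v)) (fun w => g' (g w)) t.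
Proof.
move=> lf' lg' lf lg; apply: tlift_tmap => //.
by apply: bilinear_comp lf' lg'; exact: tens_bilinear.
Qed.

(** Naturality of the middle swap: both sides are bilinear in [s] and [t], so comparing them on pure
    tensors suffices. *)
Lemma tswap_mid_tmap (V1 V2 V3 V4 W1 W2 W3 W4 : lmodType k)
    (f1 : V1 -> W1) (f2 : V2 -> W2) (f3 : V3 -> W3) (f4 : V4 -> W4) s t :
  linear f1 -> linear f2 -> linear f3 -> linear f4 ->
  tswap_mid (tmap f1 f2 s ⊗ tmap f3 f4 t) =
    tmap (tmap f1 f3) (tmap f2 f4) (tswap_mid (s ⊗ t)).
Proof.
move=> l1 l2 l3 l4.
have l13 := tmap_linear l1 l3; have l24 := tmap_linear l2 l4.
have l12 := tmap_linear l1 l2; have l34 := tmap_linear l3 l4.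
have lM := tmap_linear l13 l24.
move: s t; apply: tens_ext2.
- by split=> [t|s] a y z /=; rewrite ?l12 ?l34 ?tensPl ?tensPr linearP.
- by split=> [t|s] a y z /=; rewrite ?tensPl ?tensPr linearP lM.
by move=> v w v' w'; rewrite !(tmap_tens, tswap_midE).
Qed.

End LinearMaps.

(** * Coalgebra maps, tensor products of them, and multiplication by a group-like element *)

Section CoalgebraMaps.
Variable k : fieldType.

Lemma idfun_coalgebra_map (C : coalgType k) : coalgebra_map (@idfun C).
Proof.
split=> // c; rewrite (tens_span (comul c)) linear0_sum; last exact: tmap_linear.
by apply: eq_bigr => p _; rewrite tmap_tens.
Qed.

Lemma coalgebra_map_comp (C D E : coalgType k) (f : C -> D) (g : D -> E) :
  coalgebra_map f -> coalgebra_map g -> coalgebra_map (fun c => g (f c)).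
Proof.
move=> [lf df ef] [lg dg eg]; split=> [|c|c]; first exact: linear_comp.
- by rewrite dg df tmap_comp.
- by rewrite eg ef.
Qed.

(** The comultiplication of a tensor product is the middle swap after Δ ⊗ Δ, so the claim reduces to
    naturality of the swap. *)
Lemma tmap_coalgebra_map (C D C' D' : coalgType k) (f : C -> C') (g : D -> D') :
  coalgebra_map f -> coalgebra_map g -> coalgebra_map (tmap f g).
Proof.
move=> [lf df ef] [lg dg eg]; have lfg := tmap_linear lf lg.
have dE (E F : coalgType k) (u : E) (v : F) :
  comul (u ⊗ v) = tswap_mid (comul u ⊗ comul v) := tcomulE u v.
have eE (E F : coalgType k) (u : E) (v : F) :
  counit (u ⊗ v) = counit u * counit v := tcounitE u v.
split=> //.
  apply: (tens_ext (f := fun t => comul (tmap f g t))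
    (g := fun t => tmap (tmap f g) (tmap f g) (comul t))).
  - by move=> a y z; rewrite lfg linearP.
  - by move=> a y z; rewrite linearP (tmap_linear lfg lfg).
  by move=> c d; rewrite tmap_tens // !dE df dg tswap_mid_tmap.
apply: (tens_ext (U := k^o) (f := fun t => counit (tmap f g t))
  (g := fun t => counit t)).
- by move=> a y z; rewrite lfg; exact: linearP.
- by move=> a y z; exact: linearP.
by move=> c d; rewrite tmap_tens // !eE ef eg.
Qed.

Lemma comul_mul (H : coalgType k) (m : H -> H -> H) a b :
  nonunital_bialgebra m ->
  comul (m a b) =
    tmap (tlift m) (tlift m) (tswap_mid (comul a ⊗ comul b)).
Proof.
case=> bm _ [_ dm _]; have := dm (a ⊗ b); rewrite tliftE // => ->.
by congr tmap; exact: tcomulE.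
Qed.

Lemma counit_mul (H : coalgType k) (m : H -> H -> H) a b :
  nonunital_bialgebra m -> counit (m a b) = counit a * counit b.
Proof.
case=> bm _ [_ _ em]; have := em (a ⊗ b); rewrite tliftE // => ->.
exact: tcounitE.
Qed.

(** Since Δ(g) = g ⊗ g, multiplicativity of Δ gives Δ(a g) = a_1 g ⊗ a_2 g. Applied to [circ], this
    makes σ_x a coalgebra map. *)
Lemma mul_grouplike_coalgebra_map (H : coalgType k) (m : H -> H -> H) g :
  nonunital_bialgebra m -> grouplike g -> coalgebra_map (fun a => m a g).
Proof.
move=> nb [dg eg]; have [bm _ _] := nb; have lm := tlift_linear bm.
split=> [|c|c]; first exact: bm.1; last by rewrite counit_mul // eg mulr1.
rewrite comul_mul // dg; move: (comul c); apply: tens_ext.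
- by move=> a y z; rewrite tensPl linearP (tmap_linear lm lm).
- by apply: tmap_linear; exact: bm.1.
move=> v w; rewrite tswap_midE !tmap_tens ?tliftE //; exact: bm.1.
Qed.

End CoalgebraMaps.

(** * The convolution monoid of linear maps from a coalgebra to an algebra *)

Section Convolution.
Variables (k : fieldType) (C : coalgType k) (A : lmodType k).
Variables (m : A -> A -> A) (one : A).
Hypotheses (bm : bilinear_map m) (mA : associative m).
Hypotheses (m1l : left_id one m) (m1r : right_id one m).
Implicit Types f g h : C -> A.

Definition conv f g (c : C) : A := sweedler (fun c1 c2 => m (f c1) (g c2)) c.

Definition conv1 (c : C) : A := counit c *: one.

Lemma conv_linear f g : linear f -> linear g -> linear (conv f g).
Proof.
move=> lf lg a u v; rewrite /conv /sweedler linearP.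
exact: (tlift_linear (bilinear_comp bm lf lg)).
Qed.

Lemma convA f g h : linear f -> linear g -> linear h ->
  conv f (conv g h) = conv (conv f g) h.
Proof.
move=> lf lg lh; apply: funext => c.
have bfg := bilinear_comp bm lf lg; have bgh := bilinear_comp bm lg lh.
(* [P] induces u ⊗ (v ⊗ w) ↦ f(u) g(v) h(w). The two bracketings are its values on the two sides of
   coassociativity [comulA]. *)
pose P c1 t := m (f c1) (tlift (fun c2 c3 => m (g c2) (h c3)) t).
have bP : bilinear_map P := bilinear_comp bm lf (tlift_linear bgh).
have lP := tlift_linear bP.
have -> : conv f (conv g h) c = tlift P (tmap idfun comul (comul c)).
  by rewrite tlift_tmap //; exact: linearP.
rewrite -comulA /conv /sweedler; move: (comul c); apply: tens_ext.
- by move=> a y z; rewrite !linearP lP.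
- by apply: tlift_linear; apply: bilinear_comp (conv_linear lf lg) lh.
move=> c1 c2; rewrite tmapE tliftE; last first.
  exact: bilinear_comp (conv_linear lf lg) lh.
rewrite /sweedler /=; move: (comul c1); apply: tens_ext.
- by move=> a y z; rewrite tensPl linearP lP.
- by move=> a y z; rewrite (tlift_linear bfg); exact: bm.1.
by move=> u v; rewrite tassocE !tliftE // /P tliftE // mA.
Qed.

Lemma conv1f f : linear f -> conv conv1 f = f.
Proof.
move=> lf; apply: funext => c; rewrite -[in RHS](counitl c) linear_tlift //.
apply: eq_tlift => c1 c2.
by rewrite (linear_mapZ _ _ (bm.1 _)) m1l linear_mapZ.
Qed.

Lemma convf1 f : linear f -> conv f conv1 = f.
Proof.
move=> lf; apply: funext => c; rewrite -[in RHS](counitr c) linear_tlift //.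
apply: eq_tlift => c1 c2.
by rewrite (linear_mapZ _ _ (bm.2 _)) m1r linear_mapZ.
Qed.

(** Translates the Sweedler form of the truss axiom into convolution. *)
Lemma sweedler3_conv f g h c :
  sweedler3 (fun c1 c2 c3 => m (m (f c1) (g c2)) (h c3)) c
    = conv f (conv g h) c.
Proof.
apply: eq_tlift => c1 c'; rewrite linear_tlift; last exact: bm.2.
by apply: eq_tlift => c2 c3; rewrite mA.
Qed.

(** The monoid computation g = g * (f * h) = (g * f) * h = h. *)
Lemma conv_inverse_unique f g h : linear f -> linear g -> linear h ->
  conv g f = conv1 -> conv f h = conv1 -> g = h.
Proof.
move=> lf lg lh gf fh.
by rewrite -(convf1 lg) -fh convA // gf conv1f.
Qed.

End Convolution.

(** * Antipodes, group-like elements and the twisted Hopf algebra *)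

Section HopfAlgebra.
Variables (k : fieldType) (H : coalgType k).
Variables (dot : H -> H -> H) (one : H) (S : H -> H).
Hypothesis hopf : hopf_algebra dot one S.

Let bm : bilinear_map dot := nb_bilinear (ha_nonunital hopf).
Let lS : linear S := ha_antipode_linear hopf.
Let dotA : associative dot := nb_assoc (ha_nonunital hopf).
Let dot1l : left_id one dot := ha_left_id hopf.
Let dot1r : right_id one dot := ha_right_id hopf.

(** As f(c)_1 ⊗ f(c)_2 = f(c_1) ⊗ f(c_2), this is the antipode axiom evaluated at f(c). *)
Lemma antipode_conv_left (C : coalgType k) (f : C -> H) : coalgebra_map f ->
  conv dot (fun c => S (f c)) f = conv1 one.
Proof.
case=> lf df ef; apply: funext => c.
rewrite /conv1 -ef -(ha_antipode_left hopf) /sweedler df tlift_tmap //.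
exact: (bilinear_comp (g := idfun) bm lS).
Qed.

Lemma antipode_conv_right (C : coalgType k) (f : C -> H) : coalgebra_map f ->
  conv dot f (fun c => S (f c)) = conv1 one.
Proof.
case=> lf df ef; apply: funext => c.
rewrite /conv1 -ef -(ha_antipode_right hopf) /sweedler df tlift_tmap //.
exact: (bilinear_comp (f := idfun) bm).
Qed.

Lemma antipode_grouplike_mull g : grouplike g -> dot (S g) g = one.
Proof.
case=> dg eg; have := ha_antipode_left hopf g.
rewrite /sweedler dg eg scale1r tliftE //.
exact: (bilinear_comp (g := idfun) bm lS).
Qed.

Lemma antipode_grouplike_mulr g : grouplike g -> dot g (S g) = one.
Proof.
case=> dg eg; have := ha_antipode_right hopf g.
rewrite /sweedler dg eg scale1r tliftE //.
exact: (bilinear_comp (f := idfun) bm).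
Qed.

(** From S(g) g = 1 follows Δ(S g)(g ⊗ g) = 1 ⊗ 1; right multiplication by S(g) ⊗ S(g) then cancels
    g ⊗ g. The counit value comes from ε(S g) ε(g) = 1. *)
Lemma antipode_grouplike g : grouplike g -> grouplike (S g).
Proof.
move=> gg; have nb := ha_nonunital hopf; have [d1 e1] := ha_one hopf.
have Sgg := antipode_grouplike_mull gg; have gSg := antipode_grouplike_mulr gg.
have [lg dg _] := mul_grouplike_coalgebra_map nb gg.
split; last first.
  by have := counit_mul (S g) g nb; rewrite Sgg e1 gg.2 mulr1.
have := dg (S g); rewrite Sgg d1 => /(congr1 (tmap (dot^~ (S g)) (dot^~ (S g)))).
have lSg : linear (dot^~ (S g)) := bm.1 _.
rewrite tmap_tens // !dot1l tmap_comp // => ->.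
have -> : (fun v => dot (dot v g) (S g)) = idfun.
  by apply: funext => v; rewrite -dotA gSg dot1r.
by case: (idfun_coalgebra_map H) => _ dE _; exact: dE.
Qed.

Lemma twisted_nonunital_bialgebra g : grouplike g ->
  nonunital_bialgebra (fun a b => dot (dot a g) b).
Proof.
move=> gg; have nb := ha_nonunital hopf.
have lg : linear (dot^~ g) := bm.1 g.
have lid : linear (@idfun H) by [].
have bmg := bilinear_comp bm lg lid.
split=> //; first by move=> a b c; rewrite !dotA.
(* The twisted product factors as [dot] after (right multiplication by g) ⊗ id, a composite of
   coalgebra maps. *)
have -> : tlift (fun a b => dot (dot a g) b)
    = fun t => tlift dot (tmap (dot^~ g) idfun t).
  by apply: funext => t; rewrite tlift_tmap.
apply: coalgebra_map_comp (nb_coalgebra_map nb).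
by apply: tmap_coalgebra_map (idfun_coalgebra_map H);
  exact: mul_grouplike_coalgebra_map.
Qed.

Lemma twisted_hopf_algebra g : grouplike g ->
  hopf_algebra (fun a b => dot (dot a (S g)) b) g (fun a => dot (dot g (S a)) g).
Proof.
move=> gg.
have Sgg := antipode_grouplike_mull gg; have gSg := antipode_grouplike_mulr gg.
split=> //.
- exact: twisted_nonunital_bialgebra (antipode_grouplike gg).
- by move=> a; rewrite gSg dot1l.
- by move=> a; rewrite -dotA Sgg dot1r.
- exact: linear_comp (linear_comp lS (bm.2 g)) (bm.1 g).
(* Here (g S(a_1) g) S(g) a_2 = g S(a_1) a_2 = ε(a) g: the original antipode law multiplied by g on
   the left. The other side is symmetric. *)
- move=> a; rewrite -[g in RHS]dot1r -(linear_mapZ _ _ (bm.2 g)).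
  rewrite -(ha_antipode_left hopf) /sweedler (linear_tlift _ _ (bm.2 g)).
  by apply: eq_tlift => b c; rewrite -(dotA _ g) gSg dot1r dotA.
move=> a; rewrite -[g in RHS]dot1l -(linear_mapZ _ _ (bm.1 g)).
rewrite -(ha_antipode_right hopf) /sweedler.
rewrite (linear_tlift (L := dot^~ g) _ _ (bm.1 g)).
by apply: eq_tlift => b c; rewrite !dotA -(dotA b) Sgg dot1r.
Qed.

End HopfAlgebra.

(** * The truss axiom in convolution form and its twist by a group-like element *)

Section HopfTruss.
Variables (k : fieldType) (H : coalgType k).
Variables (dot circ : H -> H -> H) (one : H) (S sigma : H -> H).
Hypothesis truss : hopf_truss dot one S circ sigma.

Let hopf := ht_hopf truss.
Let bm : bilinear_map dot := nb_bilinear (ha_nonunital hopf).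
Let dotA : associative dot := nb_assoc (ha_nonunital hopf).
Let dot1l : left_id one dot := ha_left_id hopf.
Let dot1r : right_id one dot := ha_right_id hopf.
Let lsigma : linear sigma := let: And3 l _ _ := ht_sigma truss in l.
Let lT : linear (fun a => S (sigma a)) :=
  linear_comp lsigma (ha_antipode_linear hopf).
Let lR b : linear (circ^~ b) := (nb_bilinear (ht_nonunital truss)).1 b.

Lemma circ_dot_conv b c :
  circ^~ (dot b c)
    = conv dot (circ^~ b) (conv dot (fun a => S (sigma a)) (circ^~ c)).
Proof.
by apply: funext => a; rewrite (ht_distr truss) -sweedler3_conv.
Qed.

Lemma truss_sigmaE : circ^~ one = sigma.
Proof.
have co1 := mul_grouplike_coalgebra_map (ht_nonunital truss) (ha_one hopf).
have lSR := linear_comp (lR one) (ha_antipode_linear hopf).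
have lTR := conv_linear bm lT (lR one).
(* The truss axiom at b = c = 1 reads R_1 = R_1 * T * R_1, and S ∘ R_1 cancels the leading R_1. Thus
   R_1 is a right inverse of T, while σ is a left inverse. *)
have TR : conv dot (fun a => S (sigma a)) (circ^~ one) = conv1 one.
  rewrite -[LHS](conv1f bm dot1l) // -(antipode_conv_left hopf co1).
  by rewrite -(convA bm dotA) // -circ_dot_conv dot1l.
apply/esym; apply: (conv_inverse_unique bm dotA dot1l dot1r lT) => //.
exact: antipode_conv_right (ht_sigma truss).
Qed.

Lemma antipode_circ_grouplike x : grouplike x ->
  (fun a => S (circ a x))
    = conv dot (fun a => S (sigma a))
        (conv dot (circ^~ (S x)) (fun a => S (sigma a))).
Proof.
move=> gx; have co := mul_grouplike_coalgebra_map (ht_nonunital truss) gx.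
have lSR := linear_comp (lR x) (ha_antipode_linear hopf).
have lRT := conv_linear bm (lR (S x)) lT.
apply: (conv_inverse_unique bm dotA dot1l dot1r (lR x)) => //.
- exact: conv_linear.
- exact: antipode_conv_left.
(* Regrouping gives (R_x * T * R_(S x)) * T = R_(x · S x) * T = R_1 * T = σ * T, which is the
   convolution unit. *)
rewrite (convA bm dotA lT (lR _) lT) (convA bm dotA) //; last exact: conv_linear.
rewrite -circ_dot_conv (antipode_grouplike_mulr hopf gx) truss_sigmaE.
exact: antipode_conv_right (ht_sigma truss).
Qed.

Lemma twisted_hopf_truss x : grouplike x ->
  hopf_truss (fun a b => dot (dot a (S x)) b) x (fun a => dot (dot x (S a)) x)
    circ (circ^~ x).
Proof.
move=> gx; split; [exact: twisted_hopf_algebra hopf _ gx|exact: ht_nonunital truss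
  |exact: mul_grouplike_coalgebra_map (ht_nonunital truss) gx|].
move=> a b c.
have lSR := linear_comp (lR x) (ha_antipode_linear hopf).
have lRT := conv_linear bm (lR (S x)) lT.
have lTR := conv_linear bm lT (lR c).
(* The intermediate term R_b * (S ∘ σ_x) * R_c uses only the original product and antipode.
   Expanding S ∘ σ_x, the tail R_(S x) * T * R_c folds to R_(S(x) c), and then the whole folds to
   R_(b S(x) c). *)
transitivity (conv dot (circ^~ b)
    (conv dot (fun a => S (circ a x)) (circ^~ c)) a).
  rewrite antipode_circ_grouplike // -(convA bm dotA) // -(convA bm dotA) //.
  by rewrite -!circ_dot_conv dotA.
(* In the twisted axiom the middle factor is S(x) · (x S(a_2 ∘ x) x) · S(x), which collapses to
   S(a_2 ∘ x). *)
rewrite -sweedler3_conv //; apply: eq_tlift => a1 a'; apply: eq_tlift => a2 a3.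
have xSx := antipode_grouplike_mulr hopf gx.
have Sxx := antipode_grouplike_mull hopf gx.
by rewrite !dotA -(dotA _ (S x) x) Sxx dot1r -(dotA _ x (S x)) xSx dot1r.
Qed.

End HopfTruss.

Theorem proposition3p6 (k : fieldType) (H : coalgType k)
    (dot circ : H -> H -> H) (one : H) (S sigma : H -> H) (x : H) :
  hopf_truss dot one S circ sigma ->
  grouplike x ->
  exists Sx : H -> H,
    hopf_truss (fun a b => dot (dot a (S x)) b) x Sx circ (fun a => circ a x).
Proof.
move=> truss gx; exists (fun a => dot (dot x (S a)) x).
exact: twisted_hopf_truss truss _ gx.
Qed.
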